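(* Let $G$ be a finite connected non oriented graph with $n_0:=|E|\ge 1$ edges (multiple edges and loops allowed) and no vertices of degree one. For $N\ge1$ let $\omega(N)$ be the number of covering cycles of length $N$ in $G$, and for $i\ge 1$ let $$d_{\pm}(i)=\sum_{m=1}^{i}\lambda_{\pm}(m)\sum_{\substack{a_1+2a_2+\cdots+ia_i=i\\ a_1+\cdots+a_i=m}}\ \prod_{k=1}^{i}\frac{(\omega(k))^{a_k}}{a_k!\,k^{a_k}},$$ the inner sum being over nonnegative integers $a_1,\dots,a_i$, with $\lambda_+(m)=(-1)^{m+1}$ and $\lambda_-(m)=+1$. Then (upper signs together, lower signs together): a) $n\,d_{\pm}(n)=\omega(n)\mp\sum_{k=1}^{n-1}\omega(n-k)\,d_{\pm}(k)$ for $n\ge n_0$; b) $d_-(n)=d_+(n)+\sum_{i=1}^{n-1}d_+(i)\,d_-(n-i)$ for $n\ge n_0$; c) $d_{\pm}(n)=0$ for $1\le n\le n_0-1$; d) $d_{\pm}(n)=\dfrac{\omega(n)}{n}$ for $n_0\le n<2n_0$; e) $d_+(n)\le\dfrac{\omega(n)}{n}$ for $2n_0\le n<3n_0$; f) $d_-(n)\ge\dfrac{\omega(n)}{n}$ for $n\ge 2n_0$; g) $|d_+(n)|\le d_-(n)$ for all $n\ge 1$. Moreover, the number of Euler cycles in $G$ is $d_+(|E|)/2$.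
   Context: Let $G=(V,E)$ be a non oriented graph. Fix an arbitrary orientation of its edges, giving oriented edges $e_1,\dots,e_{|E|}$, and add the opposite oriented edges $e_{|E|+i}=(e_i)^{-1}$, $1\le i\le |E|$, where $(e_i)^{-1}$ has as origin the end of $e_i$ and as end the origin of $e_i$ (for a loop $e_i$, $e_{|E|+i}$ is an additional oriented loop at the same vertex, distinct from $e_i$); set $(e_{|E|+i})^{-1}=e_i$. Cycle of length $N$ in $G$: an ordered sequence $(e_{i_1},\dots,e_{i_N})$ of elements of $\{e_1,\dots,e_{2|E|}\}$ such that the end of $e_{i_k}$ is the origin of $e_{i_{k+1}}$ for $1\le k<N$, the end of $e_{i_N}$ is the origin of $e_{i_1}$ (closed), $e_{i_{k+1}}\neq (e_{i_k})^{-1}$ for $1\le k<N$ (non-backtracking), and $e_{i_1}\ne (e_{i_N})^{-1}$ (tail-less). Covering cycle of $G$: a cycle in which every edge of $G$ is present at least once, i.e. for each $1\le i\le |E|$ at least one of $e_i$, $(e_i)^{-1}$ occurs in the sequence. In $\omega(N)$, cycles are counted as sequences (circular permutations and inverses $(e_{i_N}^{-1},\dots,e_{i_1}^{-1})$ that differ as sequences are counted separately). Euler cycle: a cycle that covers each edge of $G$ exactly once (for each $i$, exactly one of $e_i,(e_i)^{-1}$ occurs, and it occurs once); Euler cycles are counted up to circular permutation and inversion. The numbers $d_\pm(i)$ are the coefficients in the formal power series expansion $e^{\mp h(z)}=1\mp\sum_{i\ge1}d_\pm(i)z^i$, where $h(z)=\sum_{N\ge1}\frac{\omega(N)}{N}z^N$.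 *)

(* Defs.v *)
From HB Require Import structures.
From mathcomp Require Import all_boot all_order all_algebra.

Set Implicit Arguments.
Unset Strict Implicit.
Unset Printing Implicit Defensive.

Import Order.TTheory GRing.Theory Num.Theory.

(** * Non oriented multigraphs *)

(* [endpoints e] has one element exactly when [e] is a loop. *)
Record mgraph (V E : finType) := MGraph {
  endpoints : E -> {set V};
  _ : forall e, 0 < #|endpoints e| <= 2
}.

Definition is_loop (V E : finType) (G : mgraph V E) (e : E) : bool :=
  #|endpoints G e| == 1.

(* A loop contributes 2 to the degree of its vertex. *)
Definition degree (V E : finType) (G : mgraph V E) (v : V) : nat :=
  \sum_(e | v \in endpoints G e) (if is_loop G e then 2 else 1).

Definition adjacent (V E : finType) (G : mgraph V E) : rel V :=
  fun u v => [exists e, endpoints G e == [set u; v]].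

Definition connected (V E : finType) (G : mgraph V E) : Prop :=
  forall u v : V, connect (adjacent G) u v.

(** * Orientations and oriented edges *)

Record orientation (V E : finType) (G : mgraph V E) := Orientation {
  src : E -> V;
  tgt : E -> V;
  _ : forall e, endpoints G e = [set src e; tgt e]
}.

(* [(e, false)] is [e] with its chosen orientation and [(e, true)] is the
   opposite oriented edge; the two are distinct even when [e] is a loop. *)
Definition oedge (E : finType) : finType := (E * bool)%type.

Definition oinv (E : finType) (x : oedge E) : oedge E := (x.1, ~~ x.2).

Definition oorigin (V E : finType) (G : mgraph V E) (o : orientation G)
  (x : oedge E) : V := if x.2 then tgt o x.1 else src o x.1.

Definition oend (V E : finType) (G : mgraph V E) (o : orientation G)
  (x : oedge E) : V := if x.2 then src o x.1 else tgt o x.1.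

(** * Cycles *)

Definition ofollows (V E : finType) (G : mgraph V E) (o : orientation G) :
  rel (oedge E) :=
  fun x y => (oend o x == oorigin o y) && (y != oinv x).

(* [path.cycle] also relates the last item to the first one, so this covers
   closedness and taillessness as well. *)
Definition is_cycle (V E : finType) (G : mgraph V E) (o : orientation G)
  (s : seq (oedge E)) : bool := cycle (ofollows o) s.

Definition is_covering (E : finType) (s : seq (oedge E)) : bool :=
  [forall e : E, ((e, false) \in s) || ((e, true) \in s)].

Definition omega (V E : finType) (G : mgraph V E) (o : orientation G)
  (N : nat) : nat :=
  #|[set t : N.-tuple (oedge E) | is_cycle o t && is_covering t]|.

(** * Euler cycles *)

(* Covering each edge exactly once forces the length to be [#|E|]. *)
Definition euler_cycles (V E : finType) (G : mgraph V E) (o : orientation G) :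
  {set #|E|.-tuple (oedge E)} :=
  [set t : #|E|.-tuple (oedge E) | is_cycle o t &&
    [forall e : E, count_mem (e, false) t + count_mem (e, true) t == 1]].

Definition cycle_inv (E : finType) (s : seq (oedge E)) : seq (oedge E) :=
  rev (map (@oinv E) s).

Definition cycle_equiv (E : finType) (N : nat) : rel (N.-tuple (oedge E)) :=
  fun s t => [exists r : 'I_N.+1,
    (val t == rot r s) || (val t == rot r (cycle_inv s))].

Definition num_euler_cycles (V E : finType) (G : mgraph V E)
  (o : orientation G) : nat :=
  #|equivalence_partition (@cycle_equiv E #|E|) (euler_cycles o)|.

(** * The numbers d_+ and d_- *)

Local Open Scope ring_scope.

Inductive pm := Plus | Minus.

Definition pm_val (s : pm) : rat := if s is Plus then 1 else -1.

Definition lambda (s : pm) (m : nat) : rat :=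
  if s is Plus then (-1) ^+ m.+1 else 1.

(* [a k], for [k : 'I_i], stands for a_(k+1); bounding its values by [i] loses
   nothing, since a_1 + 2 a_2 + ... + i a_i = i forces a_k <= i. *)
Definition d (V E : finType) (G : mgraph V E) (o : orientation G)
  (s : pm) (i : nat) : rat :=
  \sum_(1 <= m < i.+1) lambda s m *
    \sum_(a : {ffun 'I_i -> 'I_i.+1} |
           (\sum_(k < i) k.+1 * a k == i)%N && (\sum_(k < i) a k == m)%N)
      \prod_(k < i)
        ((omega o k.+1)%:R ^+ a k / ((a k)`!%:R * k.+1%:R ^+ a k)).

(* Main.v *)
Require Import Defs.
From mathcomp Require Import all_boot all_order all_algebra.
From mathcomp Require Import zify ring.

Set Implicit Arguments.
Unset Strict Implicit.
Unset Printing Implicit Defensive.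

Import Order.TTheory GRing.Theory Num.Theory.
Local Open Scope ring_scope.

(** Write [h(z)] for the sum of [omega(N) / N z^N].  The inner sums defining
    [d] are the coefficients of [h^m / m!], and [lambda] is chosen so that
    [exp(-+h) = 1 -+ sum d_+-(i) z^i].

    The exponential satisfies [f' = -+h' f].  Reading off the coefficient of
    [z^(n-1)] gives the recurrence (a), for every [n >= 1] ([d_rec]); and
    [exp(h) exp(-h) = 1] gives (b) ([d_inv]).  Both are obtained with
    truncated polynomials: [expser N y] is the product over [1 <= k <= N] of the
    truncated exponentials of [y_k X^k].  Expanding this product yields the sum
    over the exponents [a_k] ([exp_coef_partition]), while the product rule
    yields the differential equation modulo [X^N] ([logder_expser]).

    All of (c)-(g) then follow from (a) and one combinatorial fact: a covering
    cycle has length at least [n0 = |E|], that is [omega(k) = 0] for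
    [k < n0] ([omega_small]).  In the convolution of (a), a nonzero term needs
    [n - k >= n0] and, by (c), [k >= n0]; so the convolution vanishes for
    [n < 2 n0], and for [n < 3 n0] it only involves [d(k) = omega(k) / k >= 0].
    For [d_-] all signs are positive, and (f), (g) come from the recurrence by
    positivity and the triangle inequality.

    Finally, a covering cycle of length [|E|] traverses each edge exactly once,
    so these sequences are the Euler cycles before identification.  The
    [2 |E|] sequences obtained from one of them by rotation and inversion are
    distinct ([card_cycle_class]), because no oriented edge occurs together
    with its opposite.  Hence the number of Euler cycles is
    [omega(|E|) / (2 |E|)], which is [d_+(|E|) / 2] by (d). *)

(** * Polynomials modulo a power of the variable *)

Section Truncation.
Variable F : nzRingType.
Implicit Types p q : {poly F}.

(** Congruence modulo ['X^N], phrased on coefficients so that it makes sense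
    over any ring and needs no division. *)
Definition eqmodX N p q := forall i, (i < N)%N -> p`_i = q`_i.

Lemma eqmodX_mul N p p' q q' :
  eqmodX N p p' -> eqmodX N q q' -> eqmodX N (p * q) (p' * q').
Proof.
move=> pp' qq' i iN; rewrite !coefM; apply: eq_bigr => j _.
by rewrite pp' ?qq' //; have := ltn_ord j; lia.
Qed.

Lemma eqmodX_add N p p' q q' :
  eqmodX N p p' -> eqmodX N q q' -> eqmodX N (p + q) (p' + q').
Proof. by move=> pp' qq' i iN; rewrite !coefD pp' ?qq'. Qed.

Lemma eqmodX_prod N (I : Type) (r : seq I) (P : pred I) (f g : I -> {poly F}) :
  (forall i, P i -> eqmodX N (f i) (g i)) ->
  eqmodX N (\prod_(i <- r | P i) f i) (\prod_(i <- r | P i) g i).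
Proof.
move=> fg; apply: (big_ind2 (eqmodX N)) => //.
by move=> p p' q q'; apply: eqmodX_mul.
Qed.

End Truncation.

(** * Truncated exponentials *)

Section Exponential.
Variable F : numFieldType.
Implicit Types (y : nat -> F) (p q h g : {poly F}) (n N k : nat).

(** The exponential of [c X^k], truncated after the term of index [N]. *)
Definition expX N (c : F) k : {poly F} :=
  \sum_(j < N.+1) (c ^+ j / j`!%:R) *: 'X^(k * j).

Lemma coef_expX N c k i :
  (expX N c k)`_i = \sum_(0 <= j < N.+1 | (k * j == i)%N) c ^+ j / j`!%:R.
Proof.
by rewrite /expX coef_sumMXn big_mkord.
Qed.

(** The terms of index [j > n] have degree [k j > n] because [k > 0]. *)
Lemma expX_trunc n N c k :
  (0 < k)%N -> (n <= N)%N -> eqmodX n.+1 (expX N c k) (expX n c k).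
Proof.
move=> k0 nN i iN; rewrite !coef_expX (@big_cat_nat _ _ _ n.+1) //=.
rewrite [X in _ + X]big_nat_cond [X in _ + X]big1 ?addr0 // => j.
by case/andP=> /andP[nj _] /eqP; nia.
Qed.

Lemma expX_one n N c k : (n < k)%N -> eqmodX n.+1 (expX N c k) 1.
Proof.
move=> nk i iN; rewrite coef_expX coef1.
rewrite big_mkcond big_nat_recl //= muln0 big_nat_cond big1 ?addr0.
  by rewrite expr0 fact0 divr1 eq_sym; case: eqP.
by move=> j _; case: eqP => //; nia.
Qed.

(** [h] plays the role of the logarithmic derivative [p' / p], to precision
    ['X^N]; like it, it turns products into sums. *)
Definition logder N p h := eqmodX N p^`() (h * p).

(** The derivative of the exponential truncated at [N] is the expected multiple
    of the one truncated at [N - 1], and dropping the last term of the truncation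
    does not change it modulo ['X^N]. *)
Lemma logder_expX N c k :
  (0 < k)%N -> logder N (expX N c k) ((c *+ k) *: 'X^(k.-1)).
Proof.
rewrite /logder; case: N => [|N] k0; first by [].
have -> : (expX N.+1 c k)^`() = ((c *+ k) *: 'X^(k.-1)) * expX N c k.
  rewrite /expX raddf_sum big_ord_recl /= muln0 expr0.
  rewrite linearZ /= derivC scaler0 add0r mulr_sumr; apply: eq_bigr => j _.
  rewrite linearZ /= derivXn -scalerAl -scalerAr -exprD.
  have -> : (k * bump 0 j).-1 = (k.-1 + k * j)%N by rewrite /bump; nia.
  rewrite -scaler_nat !scalerA; congr (_ *: _).
  rewrite /bump add1n factS exprS !natrM -[c *+ k]mulr_natr.
  by field; rewrite nat1r !pnatr_eq0 -lt0n fact_gt0.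
apply: eqmodX_mul => //.
by move=> i iN; rewrite -(expX_trunc c k0 (leqnSn N)).
Qed.

Lemma logder_mul N p q h g :
  logder N p h -> logder N q g -> logder N (p * q) (h + g).
Proof.
rewrite /logder derivM => hp hq.
have -> : (h + g) * (p * q) = h * p * q + p * (g * q) by ring.
by apply: eqmodX_add; apply: eqmodX_mul.
Qed.

(** The exponential of the sum of the [y_k X^k], correct up to degree [N]: the
    factors are indexed by [k = 1, ..., N]. *)
Definition expser N y : {poly F} := \prod_(k < N) expX N (y k.+1) k.+1.

(** The coefficient of [X^n] in the full exponential series; by [coef_expser]
    the truncation order [n] may be replaced by any larger one. *)
Definition exp_coef y n : F := (expser n y)`_n.

(** Up to degree [n], each factor with [k <= n] only depends on its first terms,
    and each factor with [k > n] is congruent to 1. *)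
Lemma expser_trunc n N y :
  (n <= N)%N -> eqmodX n.+1 (expser N y) (expser n y).
Proof.
move=> nN; rewrite /expser.
rewrite -(big_mkord xpredT (fun k => expX N (y k.+1) k.+1)).
rewrite -(big_mkord xpredT (fun k => expX n (y k.+1) k.+1)).
rewrite (@big_cat_nat _ _ _ n) //= -[X in eqmodX _ _ X]mulr1.
apply: eqmodX_mul; first by apply: eqmodX_prod => k _; apply: expX_trunc.
have prod1 : \prod_(n <= k < N) (1 : {poly F}) = 1 by rewrite big1.
rewrite -[X in eqmodX _ _ X]prod1.
rewrite big_nat [X in eqmodX _ _ X]big_nat.
by apply: eqmodX_prod => k /andP[nk _]; apply: expX_one.
Qed.

Lemma coef_expser n N y : (n <= N)%N -> (expser N y)`_n = exp_coef y n.
Proof. by move=> nN; apply: expser_trunc. Qed.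

Lemma eq_exp_coef y y' n : y =1 y' -> exp_coef y n = exp_coef y' n.
Proof.
move=> yy'; rewrite /exp_coef; congr ((_ : {poly F})`_n).
by apply: eq_bigr => k _; rewrite yy'.
Qed.

Lemma exp_coef0 y : exp_coef y 0 = 1.
Proof. by rewrite /exp_coef /expser big_ord0 coef1. Qed.

Lemma logder_expser N y :
  logder N (expser N y) (\poly_(k < N) (y k.+1 *+ k.+1)).
Proof.
rewrite poly_def; apply: (big_ind2 (logder N)).
- by move=> i iN; rewrite derivC mul0r.
- by move=> p h q g; apply: logder_mul.
by move=> k _; apply: logder_expX.
Qed.

(** The coefficient of [X^(n-1)] in [f' = (sum k y_k X^(k-1)) f]. *)
Lemma exp_coef_rec y n :
  n%:R * exp_coef y n =
  \sum_(0 <= k < n) (n - k)%:R * y (n - k)%N * exp_coef y k.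
Proof.
case: n => [|n]; first by rewrite mul0r big_geq.
rewrite -(coef_expser y (leqnn n.+1)) mulr_natl -coef_deriv logder_expser //.
rewrite coefMr big_mkord; apply: eq_bigr => k _.
rewrite coef_poly coef_expser; last exact: ltnW.
have kn : (k <= n)%N by rewrite -ltnS.
by rewrite ltnS leq_subr subSn // mulr_natl.
Qed.

(** The coefficient of [X^n] in [exp(f) exp(-f) = 1]: the logarithmic
    derivatives of the two factors cancel, so the derivative of the product is 0
    up to the truncation order, and [n] is invertible in characteristic 0. *)
Lemma exp_coef_inv y n : (0 < n)%N ->
  \sum_(0 <= i < n.+1) exp_coef y i * exp_coef (fun k => - y k) (n - i)%N = 0.
Proof.
case: n => // n _; pose z k := - y k.
have D : logder n.+1 (expser n.+1 y * expser n.+1 z) 0.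
  have -> : 0 = \poly_(k < n.+1) (y k.+1 *+ k.+1)
                + \poly_(k < n.+1) (z k.+1 *+ k.+1).
    apply/polyP => i; rewrite coefD !coef_poly coef0; case: ifP => _.
      by rewrite mulNrn subrr.
    by rewrite addr0.
  by apply: logder_mul; apply: logder_expser.
have /eqP := D n (ltnSn n).
rewrite mul0r coef0 coef_deriv mulrn_eq0 /= => /eqP pq0.
rewrite big_mkord -[RHS]pq0 coefM; apply: eq_bigr => i _.
by rewrite !coef_expser //; have := ltn_ord i; lia.
Qed.

(** Distributing the product over the sums chooses one term of index [a_k] in
    each factor; the chosen monomial has degree [sum k a_k]. *)
Lemma exp_coef_partition y n :
  exp_coef y n =
  \sum_(a : {ffun 'I_n -> 'I_n.+1} | (\sum_(k < n) k.+1 * a k == n)%N)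
    \prod_(k < n) (y k.+1 ^+ a k / (a k)`!%:R).
Proof.
rewrite /exp_coef /expser bigA_distr_bigA /= coef_sum [RHS]big_mkcond /=.
apply: eq_bigr => a _.
rewrite scaler_prod prodrXr coefZ coefXn eq_sym.
by case: ifP => _; rewrite ?mulr1 ?mulr0.
Qed.

End Exponential.

(** * The numbers d as coefficients of exponentials *)

Section Expansion.
Variables (V E : finType) (G : mgraph V E) (o : orientation G).
Implicit Types (s : pm) (n : nat).

(** This is what makes [d] an exponential: the sign is a product of one sign per
    part, up to the overall sign in front of [d]. *)
Lemma lambdaE s m : lambda s m = - pm_val s * (- pm_val s) ^+ m.
Proof. by case: s => /=; rewrite ?exprS // opprK expr1n mulr1. Qed.

Lemma pm_val_sq s : pm_val s * pm_val s = 1.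
Proof. by case: s => /=; rewrite ?mulrNN mulr1. Qed.

(** The sum over the number [m] of parts collapses: a family [a] of weight [n]
    contributes to [m = sum a_k] only, and its sign is absorbed into the
    [y_k]. *)
Lemma d_exp_coef s n : (0 < n)%N ->
  d o s n =
  - pm_val s * exp_coef (fun k => - pm_val s * (omega o k)%:R / k%:R) n.
Proof.
move=> n0; rewrite /d exp_coef_partition big_distrr /=.
under eq_bigr => m _ do rewrite big_distrr /=.
rewrite (exchange_big_dep (fun a : {ffun 'I_n -> 'I_n.+1} =>
  (\sum_(k < n) k.+1 * a k == n)%N)) /=; last by move=> m a _ /andP[].
apply: eq_bigr => a /eqP wa; rewrite wa eqxx /=.
set M := (\sum_(k < n) a k)%N.
(* This is the range of the outer sum; M > 0 because n > 0. *)
have Mn : (0 < M <= n)%N.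
  apply/andP; split; last first.
    by rewrite -[X in (_ <= X)%N]wa; apply: leq_sum => k _; apply: leq_pmull.
  rewrite lt0n; apply: contraTneq n0 => /eqP; rewrite sum_nat_eq0 => /forallP a0.
  rewrite -wa big1 // => k _.
  by have /eqP-> := a0 k; rewrite muln0.
rewrite big_mkcond (bigD1_seq M) ?iota_uniq ?mem_index_iota //= eqxx.
rewrite [X in _ + X]big1 ?addr0; last by move=> m; rewrite eq_sym => /negPf ->.
rewrite lambdaE -mulrA; congr (_ * _).
rewrite /M -prodrXr -big_split /=; apply: eq_bigr => k _.
by rewrite !exprMn exprVn invfM; ring.
Qed.

Lemma exp_coef_d s n : (0 < n)%N ->
  exp_coef (fun k => - pm_val s * (omega o k)%:R / k%:R) n = - pm_val s * d o s n.
Proof. by move=> n0; rewrite d_exp_coef // mulrA mulrNN pm_val_sq mul1r. Qed.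

(** In [exp_coef_rec] the term [k = 0] gives [omega(n)]; in the others the signs
    coming from [y] and from [d_exp_coef] cancel. *)
Lemma d_rec s n : (0 < n)%N ->
  n%:R * d o s n =
  (omega o n)%:R
    - pm_val s * \sum_(1 <= k < n) (omega o (n - k))%:R * d o s k.
Proof.
move=> n0; rewrite d_exp_coef // mulrCA exp_coef_rec big_ltn // exp_coef0 subn0.
rewrite mulrDr; congr (_ + _).
  have nz : n%:R != 0 :> rat by rewrite pnatr_eq0 -lt0n.
  rewrite mulr1 [n%:R * _]mulrC divfK // mulrA mulrNN pm_val_sq mul1r //.
rewrite -mulNr; congr (_ * _); rewrite !big_nat; apply: eq_bigr => k.
case/andP=> k0 kn; rewrite exp_coef_d //.
have nz : (n - k)%:R != 0 :> rat by rewrite pnatr_eq0 -lt0n subn_gt0.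
rewrite [(n - k)%:R * _]mulrC divfK // mulrACA mulrNN pm_val_sq mul1r //.
Qed.

(** The extreme terms of [exp_coef_inv] are [d_-(n)] and [-d_+(n)]. *)
Lemma d_inv n : (0 < n)%N ->
  d o Minus n =
  d o Plus n + \sum_(1 <= i < n) d o Plus i * d o Minus (n - i)%N.
Proof.
move=> n0.
pose y s k : rat := - pm_val s * (omega o k)%:R / k%:R.
have yN k : - y Plus k = y Minus k by rewrite /y /=; ring.
have yP k : (0 < k)%N -> exp_coef (y Plus) k = - d o Plus k.
  by move=> k0; rewrite exp_coef_d //= mulN1r.
have yM k : (0 < k)%N -> exp_coef (y Minus) k = d o Minus k.
  by move=> k0; rewrite exp_coef_d //= opprK mul1r.
have := exp_coef_inv (y Plus) n0.
under eq_bigr => i _ do rewrite (eq_exp_coef _ yN).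
rewrite big_ltn // big_nat_recr //= subn0 subnn !exp_coef0 mul1r mulr1 yP // yM //.
under eq_big_nat => i /andP[i0 ni] do rewrite yP // yM ?subn_gt0 // mulNr.
rewrite sumrN => /eqP.
by rewrite -opprD subr_eq0 addrC => /eqP.
Qed.

(** * Consequences of the length bound on covering cycles *)

Lemma size_covering (t : seq (oedge E)) :
  is_covering t -> (#|E| <= size t)%N.
Proof.
move=> /forallP cov; rewrite cardE -(size_map fst t).
apply: uniq_leq_size (enum_uniq _) _ => e _.
by case/orP: (cov e) => et; apply/mapP; [exists (e, false)|exists (e, true)].
Qed.

Lemma omega_small N : (N < #|E|)%N -> omega o N = 0%N.
Proof.
move=> NE; apply/eqP; rewrite cards_eq0; apply/eqP/setP => t; rewrite !inE.
apply/negbTE; rewrite negb_and orbC; apply/orP; left.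
by apply: contraL NE => /size_covering; rewrite size_tuple -leqNgt.
Qed.

Lemma d_small s n : (0 < n < #|E|)%N -> d o s n = 0.
Proof.
case/andP=> n0 nE; apply/eqP.
have nz : n%:R != 0 :> rat by rewrite pnatr_eq0 -lt0n.
rewrite -(mulrI_eq0 _ (lregP nz)) d_rec // omega_small // big_nat big1.
  by rewrite mulr0 subr0.
by move=> k /andP[k0 kn]; rewrite omega_small ?mul0r //; lia.
Qed.

(** A length [n < 2 |E|] cannot be split into two parts of length at least
    [|E|], so every term of the convolution has a zero factor. *)
Lemma d_one_covering s n : (0 < n)%N -> (n < 2 * #|E|)%N ->
  d o s n = (omega o n)%:R / n%:R.
Proof.
move=> n0 nE; have nz : n%:R != 0 :> rat by rewrite pnatr_eq0 -lt0n.
apply: (mulfI nz); rewrite d_rec // big_nat big1.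
  by rewrite mulr0 subr0 mulrC divfK.
move=> k /andP[k0 kn]; have [kE|Ek] := ltnP k #|E|.
  by rewrite d_small ?mulr0 // k0.
by rewrite omega_small ?mul0r //; lia.
Qed.

Lemma d_minus_ge0 n : (0 < n)%N -> 0 <= d o Minus n.
Proof.
elim/ltn_ind: n => n IH n0.
have nz : 0 < n%:R :> rat by rewrite ltr0n.
rewrite -(pmulr_rge0 _ nz) d_rec //= mulN1r opprK addr_ge0 //.
rewrite big_nat; apply: sumr_ge0 => k /andP[k0 kn].
by rewrite mulr_ge0 // IH.
Qed.

Lemma d_minus_ge n : (0 < n)%N -> (omega o n)%:R / n%:R <= d o Minus n.
Proof.
move=> n0; have nz : 0 < n%:R :> rat by rewrite ltr0n.
rewrite ler_pdivrMr // mulrC d_rec //= mulN1r opprK lerDl.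
rewrite big_nat; apply: sumr_ge0 => k /andP[k0 kn].
by rewrite mulr_ge0 // d_minus_ge0.
Qed.

(** If [n < 3 |E|] and [omega(n - k)] is nonzero then [k < 2 |E|], where [d_+]
    is explicit and nonnegative. *)
Lemma d_plus_le n : (0 < n < 3 * #|E|)%N ->
  d o Plus n <= (omega o n)%:R / n%:R.
Proof.
case/andP=> n0 nE; have nz : 0 < n%:R :> rat by rewrite ltr0n.
rewrite ler_pdivlMr // mulrC d_rec //= mul1r gerBl.
rewrite big_nat; apply: sumr_ge0 => k /andP[k0 kn].
have [nkE|nkE] := ltnP (n - k) #|E|; first by rewrite omega_small ?mul0r.
by rewrite d_one_covering ?mulr_ge0 ?invr_ge0 //; lia.
Qed.

(** The two recurrences differ only by the sign of the convolution, so the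
    triangle inequality and induction compare them term by term. *)
Lemma norm_d_plus n : (0 < n)%N -> `|d o Plus n| <= d o Minus n.
Proof.
elim/ltn_ind: n => n IH n0; have nz : 0 < n%:R :> rat by rewrite ltr0n.
rewrite -(ler_pM2l nz) -[X in X * _ <= _](gtr0_norm nz) -normrM !d_rec //=.
rewrite mul1r mulN1r opprK (le_trans (ler_normB _ _)) //.
rewrite ger0_norm // lerD2l (le_trans (ler_norm_sum _ _ _)) //.
rewrite [X in X <= _]big_nat [X in _ <= X]big_nat; apply: ler_sum => k /andP[k0 kn].
by rewrite normrM ger0_norm // ler_wpM2l // IH.
Qed.

End Expansion.

(** * Euler cycles *)

Section EulerCycles.
Variables (V E : finType) (G : mgraph V E) (o : orientation G).
Implicit Types (s t : seq (oedge E)) (e : E) (b : bool) (r : nat).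

Local Notation edges s := (map (@fst E bool) s).

Lemma count_mem_edges s e :
  (count_mem (e, false) s + count_mem (e, true) s)%N = count_mem e (edges s).
Proof. by elim: s => [|[f []] s IH] //=; rewrite -IH !xpair_eqE /=; lia. Qed.

Lemma covering_edges s : is_covering s = [forall e, e \in edges s].
Proof.
apply: eq_forallb => e; apply/orP/mapP => [[] es|[[f []] fs /= ->]].
- by exists (e, false).
- by exists (e, true).
- by right.
by left.
Qed.

(** A list of length [|E|] that meets every edge has no room for repetitions. *)
Lemma covering_uniq s :
  size s = #|E| -> is_covering s -> uniq (edges s).
Proof.
move=> sE; rewrite covering_edges => /forallP cov.
apply: leq_size_uniq (enum_uniq E) _ _ => [e _|]; first exact: cov.
by rewrite size_map sE cardE.
Qed.

Lemma euler_cyclesE :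
  euler_cycles o = [set t : #|E|.-tuple _ | is_cycle o t && is_covering t].
Proof.
apply/setP => t; rewrite !inE; congr (_ && _).
apply/forallP/idP => [once|cov e].
  rewrite covering_edges; apply/forallP => e.
  by rewrite -has_pred1 has_count -count_mem_edges (eqP (once e)).
rewrite count_mem_edges count_uniq_mem ?covering_uniq ?size_tuple //.
by move: cov; rewrite covering_edges => /forallP->.
Qed.

Lemma oinvK : involutive (@oinv E).
Proof. by case=> e b; rewrite /oinv /= negbK. Qed.

(** Together with the rotations this gives the dihedral symmetries, indexed so
    that composition is [(+)] on the flags. *)
Definition reversal b s := if b then cycle_inv s else s.

Lemma cycle_invK : involutive (@cycle_inv E).
Proof. by move=> s; rewrite /cycle_inv map_rev revK mapK //; exact: oinvK. Qed.

Lemma cycle_inv_rot r s : exists r', cycle_inv (rot r s) = rot r' (cycle_inv s).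
Proof. by eexists; rewrite /cycle_inv map_rot rev_rot. Qed.

Lemma size_reversal b s : size (reversal b s) = size s.
Proof. by case: b; rewrite //= size_rev size_map. Qed.

Lemma mem_cycle_inv x s : (x \in cycle_inv s) = (oinv x \in s).
Proof. by rewrite mem_rev -{1}[x]oinvK mem_map //; apply: inv_inj oinvK. Qed.

Lemma edges_cycle_inv s : edges (cycle_inv s) = rev (edges s).
Proof. by rewrite map_rev -map_comp. Qed.

Lemma oend_inv x : oend o (oinv x) = oorigin o x.
Proof. by case: x => e []. Qed.

Lemma oorigin_inv x : oorigin o (oinv x) = oend o x.
Proof. by case: x => e []. Qed.

Lemma is_cycle_inv s : is_cycle o (cycle_inv s) = is_cycle o s.
Proof.
rewrite /is_cycle rev_cycle cycle_map; apply: eq_cycle => x y /=.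
rewrite /ofollows oend_inv oorigin_inv oinvK eq_sym; congr (_ && _).
by rewrite eq_sym.
Qed.

Lemma reversal_addb b c s :
  reversal c (reversal b s) = reversal (b (+) c) s.
Proof. by case: b c => [] [] //=; rewrite cycle_invK. Qed.

(** Rotations by arbitrary amounts may be used, since those by at least the
    length act trivially. *)
Lemma cycle_equivP N (s t : N.-tuple (oedge E)) :
  reflect (exists b r, val t = rot r (reversal b s)) (cycle_equiv s t).
Proof.
apply: (iffP existsP) => [[r /orP[] /eqP ->]|[b [r ->]]].
- by exists false, r.
- by exists true, r.
have sz : size (reversal b s) = N by rewrite size_reversal size_tuple.
have -> : rot r (reversal b s) = rot (minn r N) (reversal b s).
  by case: leqP => // Nr; rewrite !rot_oversize ?sz // ltnW.
have rN : (minn r N < N.+1)%N by rewrite ltnS geq_minr.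
by exists (Ordinal rN); case: b {sz}; rewrite /= eqxx ?orbT.
Qed.

Lemma reversal_rot b r s : exists r', reversal b (rot r s) = rot r' (reversal b s).
Proof. by case: b; [apply: cycle_inv_rot | exists r]. Qed.

(** Rotations and inversion generate a group because inversion conjugates a
    rotation into a rotation ([reversal_rot]). *)
Lemma cycle_equiv_equivalence N : equivalence_rel (@cycle_equiv E N).
Proof.
have refl : reflexive (@cycle_equiv E N).
  by move=> s; apply/cycle_equivP; exists false, 0%N; rewrite rot0.
have sym : symmetric (@cycle_equiv E N).
  suff imp (s t : N.-tuple (oedge E)) : cycle_equiv s t -> cycle_equiv t s.
    by move=> s t; apply/idP/idP; apply: imp.
  move=> /cycle_equivP[b [r ts]]; apply/cycle_equivP; exists b.
  have [r' Er] := reversal_rot b (size t - r) t; exists r'.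
  rewrite -Er -[rot _ t]/(rotr r t) ts rotK.
  by rewrite reversal_addb addbb.
have trans : transitive (@cycle_equiv E N).
  move=> t s u /cycle_equivP[b [r ts]] /cycle_equivP[c [q ut]].
  apply/cycle_equivP; exists (b (+) c).
  have [r' Er] := reversal_rot c r (reversal b s).
  by exists (rot_add (reversal (b (+) c) s) r' q);
     rewrite ut ts Er reversal_addb rot_rot_add.
apply/equivalence_relP; split=> // s t st u.
by apply/idP/idP; apply: trans; rewrite // sym.
Qed.

Lemma rot_inj_lt s r q :
  uniq s -> (r < size s)%N -> (q < size s)%N -> rot r s = rot q s -> r = q.
Proof.
case: s => // x s; set u := x :: s => Uu ru qu rq.
have head k : (k < size u)%N -> nth x (rot k u) 0 = nth x u k.
  by move=> ku; rewrite nth_cat size_drop subn_gt0 ku nth_drop addn0.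
by apply/eqP; rewrite -(nth_uniq x ru qu Uu) -!head // rq.
Qed.

Lemma mem_oinv_uniq x s : uniq (edges s) -> x \in s -> oinv x \notin s.
Proof.
move=> Us xs; apply/negP => xs'.
have : count_mem x.1 (edges s) = 1%N by rewrite count_uniq_mem // map_f.
rewrite -count_mem_edges; move: xs xs'; rewrite /oinv -!has_pred1 !has_count.
case: x => e [] /=; move: (count_mem (e, false) s) (count_mem (e, true) s); lia.
Qed.

(** The dihedral group of order [2 |E|] acts freely: the flag is detected by
    whether the first oriented edge of [t] or its opposite occurs, and then the
    rotation by the position of the first entry. *)
Lemma card_cycle_class (t : #|E|.-tuple (oedge E)) :
  (0 < #|E|)%N -> t \in euler_cycles o ->
  #|[set u in euler_cycles o | cycle_equiv t u]| = (2 * #|E|)%N.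
Proof.
move=> E0 tD; have [tcyc tcov] : is_cycle o t /\ is_covering t.
  by move: tD; rewrite euler_cyclesE inE => /andP.
have Ut : uniq (edges t) by apply: covering_uniq; rewrite ?size_tuple.
have sz b : size (reversal b t) == #|E| by rewrite size_reversal size_tuple.
pose f (p : bool * 'I_#|E|) := rot_tuple p.2 (Tuple (sz p.1)).
have -> : [set u in euler_cycles o | cycle_equiv t u] = [set f p | p in setT].
  apply/setP => u; rewrite inE; apply/andP/imsetP => [[_]|[[b r] _ ->]].
    move=> /cycle_equivP[b [r ub]].
    have [rE|Er] := ltnP r #|E|.
      by exists (b, Ordinal rE) => //; apply: val_inj.
    (* A rotation by at least the length is the identity. *)
    exists (b, Ordinal E0) => //; apply: val_inj.
    by rewrite /= ub rot0 rot_oversize // (eqP (sz b)).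
  split; last by apply/cycle_equivP; exists b, r.
  rewrite euler_cyclesE inE /is_cycle /= rot_cycle -/(is_cycle o _).
  apply/andP; split; first by case: (b); rewrite //= is_cycle_inv.
  move: tcov; rewrite !covering_edges => /forallP cov; apply/forallP => e.
  by rewrite map_rot mem_rot; case: (b); rewrite /= ?edges_cycle_inv ?mem_rev.
rewrite card_in_imset ?cardsT ?card_prod ?card_bool ?card_ord //.
have Urev b : uniq (reversal b t).
  apply: (@map_uniq _ _ fst).
  by case: b; rewrite /= ?edges_cycle_inv ?rev_uniq.
move=> [b r] [c q] _ _ /(congr1 val) /= rq.
(* Only one of t and its inverse contains the first oriented edge of t. *)
have bc : b = c.
  have tx : tnth t (Ordinal E0) \in val t by apply: mem_tnth.
  move: (congr1 (fun s => tnth t (Ordinal E0) \in s) rq).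
  rewrite !mem_rot; case: (b) (c) => [] [] //=;
    by rewrite mem_cycle_inv tx (negPf (mem_oinv_uniq Ut tx)).
rewrite -bc in rq *; congr (_, _); apply: val_inj.
by apply: rot_inj_lt rq; rewrite ?(eqP (sz b)).
Qed.

Lemma num_euler_cycles_omega :
  (0 < #|E|)%N -> omega o #|E| = (num_euler_cycles o * (2 * #|E|))%N.
Proof.
move=> E0; rewrite /omega -euler_cyclesE.
have R : {in euler_cycles o & &, equivalence_rel (@cycle_equiv E #|E|)}.
  by move=> s t u _ _ _; apply: cycle_equiv_equivalence.
apply: card_uniform_partition (equivalence_partitionP R) => A /imsetP[t tD ->].
exact: card_cycle_class.
Qed.

End EulerCycles.

Theorem theorem2p4 (V E : finType) (G : mgraph V E) (o : orientation G)
  (n0 : nat) (n0E : n0 = #|E|) (n0_ge1 : (1 <= n0)%N)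
  (Gconn : connected G)
  (Gdeg : forall v : V, degree G v <> 1%N) :
  (* a *)
  (forall (s : pm) (n : nat), (n0 <= n)%N ->
     n%:R * d o s n =
     (omega o n)%:R
       - pm_val s * \sum_(1 <= k < n) (omega o (n - k))%:R * d o s k) /\
  (* b *)
  (forall n : nat, (n0 <= n)%N ->
     d o Minus n =
     d o Plus n + \sum_(1 <= i < n) d o Plus i * d o Minus (n - i)%N) /\
  (* c *)
  (forall (s : pm) (n : nat), (1 <= n <= n0 - 1)%N -> d o s n = 0) /\
  (* d *)
  (forall (s : pm) (n : nat), (n0 <= n < 2 * n0)%N ->
     d o s n = (omega o n)%:R / n%:R) /\
  (* e *)
  (forall n : nat, (2 * n0 <= n < 3 * n0)%N ->
     d o Plus n <= (omega o n)%:R / n%:R) /\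
  (* f *)
  (forall n : nat, (2 * n0 <= n)%N ->
     (omega o n)%:R / n%:R <= d o Minus n) /\
  (* g *)
  (forall n : nat, (1 <= n)%N -> `|d o Plus n| <= d o Minus n) /\
  (* Euler cycles *)
  (num_euler_cycles o)%:R = d o Plus #|E| / 2.
Proof.
split; first by move=> s n n0n; apply: d_rec; lia.
split; first by move=> n n0n; apply: d_inv; lia.
split; first by move=> s n n0n; apply: d_small; lia.
split; first by move=> s n n0n; apply: d_one_covering; lia.
split; first by move=> n n0n; apply: d_plus_le; lia.
split; first by move=> n n0n; apply: d_minus_ge; lia.
split; first by move=> n n1; apply: norm_d_plus.
have E0 : (0 < #|E|)%N by lia.
rewrite d_one_covering ?num_euler_cycles_omega //; last by lia.
by rewrite !natrM; field; rewrite pnatr_eq0 -lt0n.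
Qed.
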